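(* Let $(\mathcal C,T,E,R,\Rightarrow,d)$ be a setting for stability, let $\phi\colon T\times E\to E$ be a $T$-flow, and let $x^*\colon 1\to E$ be an equilibrium point of $\phi$. If there exists a Lyapunov morphism $V\colon E\to R$ for $\phi$ with equilibrium point $x^*$, then $x^*$ is a stable equilibrium point.
   Context: Setting for stability. It consists of: a category $\mathcal C$ with all finite products (terminal object $1$; $!\colon X\to 1$ denotes the unique morphism); an object $E$; an internal monoid $(T,\oplus\colon T\times T\to T,0_\oplus\colon 1\to T)$ in $\mathcal C$; a posetal object $R$, meaning that for every object $X$ the hom-set $\mathcal C(X,R)$ carries a partial order such that $g_1\ge g_2$ in $\mathcal C(Y,R)$ implies $g_1\circ f\ge g_2\circ f$ for every $f\colon X\to Y$; a point $0_R\colon 1\to R$; and a morphism $d\colon E\times E\to R$. For any $X$ write $0\colon X\xrightarrow{!}1\xrightarrow{0_R}R$. It is required that $d\ge 0$ in $\mathcal C(E\times E,R)$ and that the diagonal $\Delta\colon E\to E\times E$ is an equalizer of $d$ and $0$. One writes $g_1\Rightarrow g_2$ for $g_1\ge g_2$. Norm. For $x^*\colon 1\to E$, $\|\cdot\|_{x^*}:=d\circ(\mathrm{id}_E,\,x^*\circ !)\colon E\to R$. Class $\mathcal K$. A morphism $\alpha\colon R\to R$ is order-preserving if $f\ge g$ in $\mathcal C(X,R)$ implies $\alpha\circ f\ge\alpha\circ g$, for all $X$. It is of class $\mathcal K$ if it is order-preserving, has an order-preserving inverse $\alpha^{-1}$, and $\alpha\circ 0_R=0_R$. Flow and equilibrium.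 A $T$-flow on $E$ is a left action $\phi\colon T\times E\to E$ of the monoid $T$: $\phi\circ(0_\oplus\circ !,\mathrm{id}_E)=\mathrm{id}_E$ and $\phi\circ(\oplus\times\mathrm{id}_E)=\phi\circ(\mathrm{id}_T\times\phi)$. A point $x^*\colon 1\to E$ is an equilibrium point of $\phi$ if $\phi\circ(\mathrm{id}_T,x^*\circ !)=x^*\circ !\colon T\to E$. Stable. An equilibrium point $x^*$ is stable if there is a class $\mathcal K$ morphism $\alpha$ with $\alpha\circ\|\cdot\|_{x^*}\circ\pi_E\ \ge\ \|\cdot\|_{x^*}\circ\phi$ in $\mathcal C(T\times E,R)$, where $\pi_E\colon T\times E\to E$ is the projection. Lyapunov morphism. A morphism $V\colon E\to R$ is a Lyapunov morphism for $\phi$ with equilibrium point $x^*$ if (1) (positive definite) there are class $\mathcal K$ morphisms $\underline\alpha,\overline\alpha$ with $\overline\alpha\circ\|\cdot\|_{x^*}\ge V\ge\underline\alpha\circ\|\cdot\|_{x^*}$, and (2) (decrescent) $V\circ\pi_E\ge V\circ\phi$ in $\mathcal C(T\times E,R)$. *)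

(* Defs.v *)
From Stdlib Require Import Relation_Definitions.

Set Implicit Arguments.
Unset Strict Implicit.
Unset Printing Implicit Defensive.

Declare Scope cat_scope.
Delimit Scope cat_scope with cat.
Local Open Scope cat_scope.

Record category := Category {
  obj : Type;
  hom : obj -> obj -> Type;
  idc : forall X, hom X X;
  compc : forall X Y Z, hom Y Z -> hom X Y -> hom X Z;
  comp_idl : forall X Y (f : hom X Y), compc (idc Y) f = f;
  comp_idr : forall X Y (f : hom X Y), compc f (idc X) = f;
  comp_assoc : forall X Y Z W (h : hom Z W) (g : hom Y Z) (f : hom X Y),
    compc h (compc g f) = compc (compc h g) f
}.

Arguments hom {_} X Y.
Arguments idc {_} X.

Notation "g ∘ f" := (compc g f) (at level 40, left associativity) : cat_scope.

(* Finite products are given as chosen structure: a terminal object and binary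
   products. *)
Record fp_category := FPCategory {
  fp_cat :> category;
  one : obj fp_cat;
  bang : forall X, hom X one;
  bang_uniq : forall X (f : hom X one), f = bang X;
  prodc : obj fp_cat -> obj fp_cat -> obj fp_cat;
  fstc : forall X Y, hom (prodc X Y) X;
  sndc : forall X Y, hom (prodc X Y) Y;
  pairc : forall Z X Y, hom Z X -> hom Z Y -> hom Z (prodc X Y);
  fst_pair : forall Z X Y (f : hom Z X) (g : hom Z Y),
    fstc X Y ∘ pairc f g = f;
  snd_pair : forall Z X Y (f : hom Z X) (g : hom Z Y),
    sndc X Y ∘ pairc f g = g;
  pair_uniq : forall Z X Y (f : hom Z X) (g : hom Z Y) (h : hom Z (prodc X Y)),
    fstc X Y ∘ h = f -> sndc X Y ∘ h = g -> h = pairc f g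
}.

Arguments one {_}.
Arguments bang {_} X.
Arguments fstc {_} X Y.
Arguments sndc {_} X Y.

Notation "X ⊗ Y" := (prodc X Y) (at level 40, left associativity) : cat_scope.
Notation "⟨ f , g ⟩" := (pairc f g) (at level 0) : cat_scope.

Section FinProd.
Variable C : fp_category.
Implicit Types X Y Z : obj C.

Definition prod_map X Y X' Y' (f : hom X X') (g : hom Y Y') :
    hom (X ⊗ Y) (X' ⊗ Y') :=
  ⟨f ∘ fstc X Y, g ∘ sndc X Y⟩.

Definition assocc X Y Z : hom ((X ⊗ Y) ⊗ Z) (X ⊗ (Y ⊗ Z)) :=
  ⟨fstc X Y ∘ fstc (X ⊗ Y) Z,
   ⟨sndc X Y ∘ fstc (X ⊗ Y) Z, sndc (X ⊗ Y) Z⟩⟩.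

Definition diag X : hom X (X ⊗ X) := ⟨idc X, idc X⟩.

Definition const_at X Y (p : hom one Y) : hom X Y := p ∘ bang X.

Definition is_equalizer X Y Z (e : hom X Y) (f g : hom Y Z) : Prop :=
  f ∘ e = g ∘ e /\
  forall W (h : hom W Y), f ∘ h = g ∘ h -> exists! k : hom W X, e ∘ k = h.

(* The unit and associativity isomorphisms of the product, left implicit in the
   usual equations for monoids and actions, are written out. *)
Record internal_monoid := InternalMonoid {
  mon_obj :> obj C;
  mon_op : hom (mon_obj ⊗ mon_obj) mon_obj;
  mon_zero : hom one mon_obj;
  mon_assoc :
    mon_op ∘ prod_map mon_op (idc mon_obj)
    = mon_op ∘ prod_map (idc mon_obj) mon_op ∘ assocc mon_obj mon_obj mon_obj;
  mon_unitl : mon_op ∘ ⟨const_at mon_obj mon_zero, idc mon_obj⟩ = idc mon_obj;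
  mon_unitr : mon_op ∘ ⟨idc mon_obj, const_at mon_obj mon_zero⟩ = idc mon_obj
}.

Record posetal_object := PosetalObject {
  pos_obj :> obj C;
  pos_ge : forall X, relation (hom X pos_obj);
  pos_order : forall X, order (hom X pos_obj) (@pos_ge X);
  pos_precomp : forall X Y (f : hom X Y) (g1 g2 : hom Y pos_obj),
    pos_ge g1 g2 -> pos_ge (g1 ∘ f) (g2 ∘ f)
}.

End FinProd.

Arguments const_at {C} X {Y} p.
Arguments diag {C} X.
Arguments assocc {C} X Y Z.

Notation "f ⪰ g" := (pos_ge f g) (at level 70, no associativity) : cat_scope.

Record stability_setting := StabilitySetting {
  ss_cat :> fp_category;
  ss_T : internal_monoid ss_cat;
  ss_E : obj ss_cat;
  ss_R : posetal_object ss_cat;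
  ss_zero : hom one ss_R;
  ss_d : hom (ss_E ⊗ ss_E) ss_R;
  ss_d_ge0 : ss_d ⪰ const_at (ss_E ⊗ ss_E) ss_zero;
  ss_d_eq : is_equalizer (diag ss_E) ss_d (const_at (ss_E ⊗ ss_E) ss_zero)
}.

Section Stability.
Variable S : stability_setting.
Notation T := (mon_obj (ss_T S)).
Notation E := (ss_E S).
Notation R := (ss_R S).

Definition norm_at (x : hom one E) : hom E R := ss_d S ∘ ⟨idc E, const_at E x⟩.

Definition order_preserving (a : hom R R) : Prop :=
  forall X (f g : hom X R), f ⪰ g -> a ∘ f ⪰ a ∘ g.

Definition class_K (a : hom R R) : Prop :=
  order_preserving a /\
  (exists b : hom R R,
     a ∘ b = idc R /\ b ∘ a = idc R /\ order_preserving b) /\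
  a ∘ ss_zero S = ss_zero S.

Definition is_flow (phi : hom (T ⊗ E) E) : Prop :=
  phi ∘ ⟨const_at E (mon_zero (ss_T S)), idc E⟩ = idc E /\
  phi ∘ prod_map (mon_op (ss_T S)) (idc E)
  = phi ∘ prod_map (idc T) phi ∘ assocc T T E.

Definition is_equilibrium (phi : hom (T ⊗ E) E) (x : hom one E) : Prop :=
  phi ∘ ⟨idc T, const_at T x⟩ = const_at T x.

Definition is_stable_equilibrium (phi : hom (T ⊗ E) E) (x : hom one E) : Prop :=
  is_equilibrium phi x /\
  exists a : hom R R, class_K a /\
    a ∘ norm_at x ∘ sndc T E ⪰ norm_at x ∘ phi.

Definition positive_definite (x : hom one E) (V : hom E R) : Prop :=
  exists a_lo a_up : hom R R, class_K a_lo /\ class_K a_up /\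
    a_up ∘ norm_at x ⪰ V /\ V ⪰ a_lo ∘ norm_at x.

Definition decrescent (phi : hom (T ⊗ E) E) (V : hom E R) : Prop :=
  V ∘ sndc T E ⪰ V ∘ phi.

Definition is_lyapunov (phi : hom (T ⊗ E) E) (x : hom one E) (V : hom E R)
    : Prop :=
  positive_definite x V /\ decrescent phi V.

End Stability.

(* Main.v *)
Require Import Defs.
From Stdlib Require Import Relation_Definitions.

(** Sandwiching [V] between its two class K bounds along the flow gives
    [a_up ∘ ‖·‖ ∘ π ⪰ V ∘ π ⪰ V ∘ phi ⪰ a_lo ∘ ‖·‖ ∘ phi]: the outer steps are
    the bounds precomposed with the projection and with the flow, the middle one
    is the decrease of [V].  Cancelling [a_lo] by its order-preserving inverse
    leaves [a_lo⁻¹ ∘ a_up] as the gain in the definition of stability, so all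
    that remains is that class K morphisms are closed under inverses
    ([class_K_inverse]) and composition ([class_K_comp]). *)

Local Open Scope cat_scope.

Lemma pos_ge_trans (C : fp_category) (R : posetal_object C) (X : obj C)
    (f g h : hom X R) : f ⪰ g -> g ⪰ h -> f ⪰ h.
Proof. apply (ord_trans _ _ (pos_order R X)). Qed.

Section ClassK.
Variable S : stability_setting.
Notation R := (ss_R S).

Lemma class_K_comp (a b : hom R R) :
  class_K a -> class_K b -> class_K (a ∘ b).
Proof.
  intros [Ha [[a' [Haa' [Ha'a Ha']]] Ha0]] [Hb [[b' [Hbb' [Hb'b Hb']]] Hb0]].
  split; [| split].
  - intros X f g Hfg. rewrite <- !comp_assoc. apply Ha, Hb, Hfg.
  - exists (b' ∘ a'). split; [| split].
    + rewrite comp_assoc, <- (comp_assoc a b b'), Hbb', comp_idr. exact Haa'.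
    + rewrite comp_assoc, <- (comp_assoc b' a' a), Ha'a, comp_idr. exact Hb'b.
    + intros X f g Hfg. rewrite <- !comp_assoc. apply Hb', Ha', Hfg.
  - rewrite <- comp_assoc, Hb0. exact Ha0.
Qed.

Lemma class_K_inverse (a : hom R R) :
  class_K a -> exists b : hom R R, class_K b /\ b ∘ a = idc R.
Proof.
  intros [Ha [[b [Hab [Hba Hb]]] Ha0]].
  exists b. split; [split; [exact Hb | split] | exact Hba].
  - exists a. auto.
  - (* [b] fixes zero because zero is [a] of itself. *)
    transitivity (b ∘ (a ∘ ss_zero S)).
    + rewrite Ha0. reflexivity.
    + rewrite comp_assoc, Hba. apply comp_idl.
Qed.

End ClassK.

Theorem theorem1 (S : stability_setting)
    (phi : hom (prodc (ss_T S) (ss_E S)) (ss_E S)) (x : hom one (ss_E S))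
    (Hphi : is_flow phi) (Hx : is_equilibrium phi x)
    (HV : exists V : hom (ss_E S) (ss_R S), is_lyapunov phi x V) :
  is_stable_equilibrium phi x.
Proof.
  destruct HV as [V [[a_lo [a_up [Klo [Kup [Hup Hlo]]]]] Hdec]].
  destruct (class_K_inverse S a_lo Klo) as [b [Kb Hb]].
  split; [exact Hx |].
  exists (b ∘ a_up). split; [apply class_K_comp; assumption |].
  assert (Hchain : a_up ∘ norm_at x ∘ sndc (ss_T S) (ss_E S)
                   ⪰ a_lo ∘ norm_at x ∘ phi).
  { apply pos_ge_trans with (V ∘ sndc (ss_T S) (ss_E S)).
    - apply pos_precomp, Hup.
    - apply pos_ge_trans with (V ∘ phi).
      + exact Hdec.
      + apply pos_precomp, Hlo. }
  apply (proj1 Kb) in Hchain.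
  rewrite !comp_assoc, Hb, comp_idl in Hchain.
  exact Hchain.
Qed.
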